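(* For any increasing function $g:\mathbb{R}^{+}\to\mathbb{Z}^{+}$ with $\lim_{r\to+\infty}g(r)=+\infty$, the metric space $X_{\omega}(g)=\mathrm{as}\bigsqcup_{i=1}^{\infty}(2^{\tilde g(i)}\mathbb{Z})^{g(i)}$, where $\tilde g(r)=\max\{k\in\mathbb{N} : ad_{(2^k\mathbb{Z})^{g(r)}}(r)=g(r)\}$, satisfies $\operatorname{trasdim}(X_{\omega}(g))=\omega$ and $ad_{X_{\omega}(g)}(r)\geq g(r)$ for every $r>0$.
   Context: $\mathbb{N}=\{1,2,3,\ldots\}$, $\mathbb{Z}^+$ is the set of positive integers; $\omega$ is the smallest infinite ordinal. ''Increasing'' means non-decreasing. Families of subsets. Let $(X,d)$ be a metric space. For $r>0$, a family $\mathcal{U}$ of subsets of $X$ is $r$-disjoint if $d(U,V)=\inf\{d(x,y):x\in U,y\in V\}>r$ for all $U\neq V$ in $\mathcal{U}$. It is uniformly bounded if $\sup\{\operatorname{diam}U:U\in\mathcal{U}\}<\infty$. Transfinite asymptotic dimension. Let $Fin\,\mathbb{N}$ be the collection of all finite nonempty subsets of $\mathbb{N}$. For $M\subseteq Fin\,\mathbb{N}$ and $\sigma\in\{\varnothing\}\cup Fin\,\mathbb{N}$ let $M^{\sigma}=\{\tau\in Fin\,\mathbb{N}:\tau\cup\sigma\in M,\ \tau\cap\sigma=\varnothing\}$, and $M^a=M^{\{a\}}$ for $a\in\mathbb{N}$. Define $\operatorname{Ord}M$ inductively: $\operatorname{Ord}M=0$ iff $M=\varnothing$; $\operatorname{Ord}M\leq\alpha$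 (for an ordinal $\alpha>0$) iff $\operatorname{Ord}M^a<\alpha$ for every $a\in\mathbb{N}$; $\operatorname{Ord}M=\alpha$ iff $\operatorname{Ord}M\leq\alpha$ and $\operatorname{Ord}M<\alpha$ is not true; $\operatorname{Ord}M=\infty$ iff $\operatorname{Ord}M\leq\alpha$ holds for no ordinal $\alpha$. For a metric space $X$, let $A(X)$ be the set of $\sigma\in Fin\,\mathbb{N}$ for which there are no uniformly bounded families $\mathcal{U}_i$ ($i\in\sigma$) of subsets of $X$ such that each $\mathcal{U}_i$ is $i$-disjoint and $\bigcup_{i\in\sigma}\mathcal{U}_i$ covers $X$. Then $\operatorname{trasdim}(X)=\operatorname{Ord}A(X)$. Asymptotic dimension function. For a cover $\mathcal{U}$ of a metric space $X$, the Lebesgue number is $L(\mathcal{U})=\inf_{x\in X}\sup\{r>0:\exists U\in\mathcal{U},\ B(x,r)\subseteq U\}$, and the multiplicity $m(\mathcal{U})$ is the maximal number of elements of $\mathcal{U}$ with a nonempty intersection. Then $ad_X(\lambda)=\min\{m(\mathcal{U}):\mathcal{U}\text{ is a uniformly bounded cover of }X\text{ with }L(\mathcal{U})\geq\lambda\}-1$. Asymptotic union. For a sequence $\{Z_i\}_{i=1}^\infty$ of subspaces of a metric space $(Z,d_Z)$, the asymptotic union $\mathrm{as}\bigsqcup_{i=1}^{\infty}Z_i$ is the disjoint union of the $Z_i$ with the metric given, for $x$ in the $l$-th summand $Z_l$ and $y$ in the $k$-th summand $Z_k$ with $l\leq k$, by $d(x,y)=d_Z(x,y)+c$, where $c=0$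 if $l=k$ and $c=l+(l+1)+\cdots+(k-1)$ if $l<k$. The spaces $(2^k\mathbb{Z})^n\subset\mathbb{R}^n$ carry the max metric, as subspaces of $(\bigoplus\mathbb{R},d_{\max})$, the finitely supported real sequences with the max metric ($\mathbb{R}^n$ being the sequences vanishing after the $n$-th coordinate).
   Formalization: The bound ad(r) ≥ g(r) is stated for r > 1, since for 0 < r ≤ 1 balls are singletons and ad(r) = 0 < g(r); and the maximum defining g̃(r), which is over an empty set for r ≤ 2, is taken to be 0 there. *)

(* Defs.v *)
From HB Require Import structures.
From mathcomp Require Import all_boot all_order all_algebra finmap.
From mathcomp Require Import all_classical all_reals all_analysis.

Set Implicit Arguments.
Unset Strict Implicit.
Unset Printing Implicit Defensive.

Import Order.TTheory GRing.Theory Num.Theory.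
Import numFieldNormedType.Exports.

Local Open Scope classical_set_scope.
Local Open Scope ring_scope.

(* Ordinal numbers, represented by well-founded trees: [osup f] stands for the
   least ordinal that is strictly greater than every [f i].  Distinct trees may
   stand for the same ordinal, so ordinals are only compared through [ole] and
   [olt]. *)

Inductive ordnum : Type := osup (K : Type) (f : K -> ordnum).

Fixpoint ole (a b : ordnum) {struct a} : Prop :=
  let: osup K f := a in
  forall i : K, let: osup L h := b in exists j : L, ole (f i) (h j).

Definition olt (a b : ordnum) : Prop :=
  let: osup L h := b in exists j : L, ole a (h j).

Definition ozero : ordnum := @osup False (fun i => False_rect _ i).

Definition osucc (a : ordnum) : ordnum := @osup unit (fun=> a).

Definition onat (n : nat) : ordnum := iter n osucc ozero.

Definition omega : ordnum := osup onat.

(* Fin N, where N = {1, 2, 3, ...} *)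
Definition FinN : set {fset nat} :=
  [set s | s != fset0 /\ 0%N \notin s].

Definition link (M : set {fset nat}) (s : {fset nat}) : set {fset nat} :=
  [set t | [/\ FinN t, M (t `|` s)%fset & (t `&` s)%fset = fset0]].

(* [Ord_le M a] is Ord M <= a, by induction: Ord M = 0 (hence Ord M <= a) iff M
   is empty and, for a > 0, Ord M <= a iff for every n in N there is b < a with
   Ord M^n <= b. *)
Inductive Ord_le (M : set {fset nat}) (a : ordnum) : Prop :=
| Ord_le_empty of M = set0
| Ord_le_pos of olt ozero a &
    (forall n : nat, (0 < n)%N ->
       exists2 b, olt b a & Ord_le (link M [fset n]%fset) b).

Definition Ord_lt (M : set {fset nat}) (a : ordnum) : Prop :=
  exists2 b, olt b a & Ord_le M b.

Definition Ord_eq (M : set {fset nat}) (a : ordnum) : Prop :=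
  Ord_le M a /\ ~ Ord_lt M a.

Section metric_families.
Context {R : realType} {X : metricType R}.
Implicit Types (U V : set X) (F : set (set X)) (r : R).

Definition set_dist U V : \bar R :=
  ereal_inf [set (mdist x y)%:E | x in U & y in V].

Definition diam U : \bar R :=
  ereal_sup [set (mdist x y)%:E | x in U & y in U].

Definition r_disjoint r F : Prop :=
  forall U V, F U -> F V -> U <> V -> (r%:E < set_dist U V)%E.

Definition uniformly_bounded F : Prop :=
  (ereal_sup [set diam U | U in F] < +oo)%E.

Definition covers F : Prop := \bigcup_(U in F) U = [set: X].

(* The inner supremum is -oo, instead of 0, when no ball around x lies in a
   member of F; this is irrelevant to [lam%:E <= Lebesgue_number F], lam > 0. *)
Definition Lebesgue_number F : \bar R :=
  ereal_inf [set ereal_sup [set r%:E | r in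
    [set r | 0 < r /\ exists2 U, F U & ball x r `<=` U]] | x in [set: X]].

Definition multiplicity F : \bar R :=
  ereal_sup [set (n%:R)%:E | n in [set n : nat | exists G : set (set X),
    [/\ G `<=` F, (G #= `I_n)%card & \bigcap_(U in G) U !=set0]]].

End metric_families.

(* The infimum is a minimum, as multiplicities lie in {0, 1, 2, ...} U {+oo};
   it is +oo exactly when no such cover has finite multiplicity. *)
Definition ad {R : realType} (X : metricType R) (lam : R) : \bar R :=
  (ereal_inf [set multiplicity F | F in [set F : set (set X) |
     [/\ uniformly_bounded F, covers F & lam%:E <= Lebesgue_number F]]] - 1)%E.

Definition A_family {R : realType} (X : metricType R) : set {fset nat} :=
  [set s | FinN s /\ ~ exists F : nat -> set (set X),
     (forall i, i \in s ->
        uniformly_bounded (F i) /\ r_disjoint (i%:R : R) (F i)) /\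
     covers (\bigcup_(i in [set` s]) F i)].

Definition trasdim_eq {R : realType} (X : metricType R) (a : ordnum) : Prop :=
  Ord_eq (A_family X) a.

Section subspace_metric.
Context {R : realType} {X : metricType R} (A : set X).

Let d (x y : A) : R := mdist (\val x : X) (\val y : X).

Let d_ge0 x y : 0 <= d x y. Proof. exact: mdist_ge0. Qed.

Let d_pos x y : d x y = 0 -> x = y.
Proof. by move/mdist_positivity; exact: val_inj. Qed.

Let ballEd (x : A) e : ball x e = [set y | d x y < e].
Proof.
apply/seteqP; split=> y /=.
  by rewrite /ball/= /initial_ball/= /d ballEmdist.
by move=> h; rewrite /ball/= /initial_ball/= ballEmdist.
Qed.

HB.instance Definition _ :=
  @PseudoMetric_isMetric.Build R (set_type A) d d_ge0 d_pos ballEd.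

End subspace_metric.

(* The finitely supported real sequences; coordinates are numbered from 0. *)
Definition dsumR (R : realType) : Type := {fsfun nat -> R with 0}.

HB.instance Definition _ (R : realType) :=
  Choice.copy (dsumR R) {fsfun nat -> R with 0}.

Section dsumR_metric.
Context {R : realType}.
Implicit Types x y z : {fsfun nat -> R with 0}.

Let d (x y : {fsfun nat -> R with 0}) : R :=
  \big[Num.max/0]_(j <- (finsupp x `|` finsupp y)%fset) `|x j - y j|.

Let d_ge0 x y : 0 <= d x y. Proof. exact: bigmax_ge_id. Qed.

Let le_d x y j : `|x j - y j| <= d x y.
Proof.
have [jxy|] := boolP (j \in (finsupp x `|` finsupp y)%fset).
  exact: (@le_bigmax_seq _ _ _ _ _ _ xpredT (fun j => `|x j - y j|)).
rewrite in_fsetU negb_or => /andP[jx jy].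
by rewrite !fsfun_dflt// subr0 normr0.
Qed.

Let d_le x y c : 0 <= c -> (forall j, `|x j - y j| <= c) -> d x y <= c.
Proof. by move=> c0 h; apply: bigmax_le. Qed.

Let d_xx x : d x x = 0.
Proof.
by apply/eqP; rewrite eq_le d_ge0 andbT d_le// => j; rewrite subrr normr0.
Qed.

Let d_pos x y : d x y = 0 -> x = y.
Proof.
move=> dxy; apply/fsfunP => j; have := le_d x y j.
by rewrite dxy normr_le0 subr_eq0 => /eqP.
Qed.

Let d_sym x y : d x y = d y x.
Proof. by rewrite /d fsetUC; apply: eq_bigr => j _; rewrite distrC. Qed.

Let d_triangle y x z : d x z <= d x y + d y z.
Proof.
apply: d_le => [|j]; first by rewrite addr_ge0.
by rewrite (le_trans (ler_distD (y j) _ _))// lerD.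
Qed.

HB.instance Definition _ :=
  @isMetric.Build R (dsumR R) d d_xx d_pos d_sym d_triangle.

End dsumR_metric.

(* The disjoint union of Z_ 1, Z_ 2, ...; the set Z_ 0 is not used. *)
Definition asunion {R : realType} {Z : metricType R} (Z_ : nat -> set Z) : Type :=
  {i : nat & Z_ i.+1}.

HB.instance Definition _ {R : realType} {Z : metricType R} (Z_ : nat -> set Z) :=
  Choice.copy (asunion Z_) {i : nat & Z_ i.+1}.

Section asunion_metric.
Context {R : realType} {Z : metricType R} (Z_ : nat -> set Z).

Let pt (x : {i : nat & Z_ i.+1}) : Z := \val (tagged x).

Let gap (l k : nat) : R := \sum_(minn l k <= j < maxn l k) j%:R.

Let d (x y : {i : nat & Z_ i.+1}) : R :=
  mdist (pt x) (pt y) + gap (tag x).+1 (tag y).+1.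

Let height (l : nat) : R := \sum_(0 <= j < l) j%:R.

Let gapC l k : gap l k = gap k l. Proof. by rewrite /gap minnC maxnC. Qed.

Let gapE l k : gap l k = `|height k - height l|.
Proof.
wlog lk : l k / (l <= k)%N.
  move=> h; have [/h//|/ltnW/h] := leqP l k.
  by rewrite gapC distrC.
rewrite /gap (minn_idPl lk) (maxn_idPr lk) /height (big_cat_nat (leq0n l) lk)/=.
by rewrite addrAC subrr add0r ger0_norm// sumr_ge0.
Qed.

Let gap_ge0 l k : 0 <= gap l k. Proof. by rewrite gapE. Qed.

Let gap_eq0 l k : gap l.+1 k.+1 = 0 -> l = k.
Proof.
wlog lk : l k / (l < k)%N.
  move=> h; have [/h//|kl|//] := ltngtP l k.
  by rewrite gapC => /(h _ _ kl).
have lk1 : (l.+1 <= k.+1)%N by rewrite ltnW.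
rewrite /gap (minn_idPl lk1) (maxn_idPr lk1) big_ltn ?ltnS// => /eqP.
rewrite paddr_eq0// ?pnatr_eq0//.
exact: sumr_ge0.
Qed.

Let d_xx x : d x x = 0. Proof. by rewrite /d mdistxx gapE subrr normr0 addr0. Qed.

Let d_pos x y : d x y = 0 -> x = y.
Proof.
move=> /eqP; rewrite paddr_eq0 ?mdist_ge0// => /andP[/eqP/mdist_positivity + /eqP/gap_eq0].
case: x y => [i x] [j y]; rewrite /pt/= => xy ij.
by case: _ / ij y xy => y /val_inj ->.
Qed.

Let d_sym x y : d x y = d y x. Proof. by rewrite /d metric_sym gapC. Qed.

Let d_triangle y x z : d x z <= d x y + d y z.
Proof.
rewrite /d addrACA lerD ?metric_triangle// !gapE.
by rewrite [leRHS]addrC; exact: ler_distD.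
Qed.

HB.instance Definition _ :=
  @isMetric.Build R (asunion Z_) d d_xx d_pos d_sym d_triangle.

End asunion_metric.

(* (2^k Z)^n *)
Definition lattice {R : realType} (k n : nat) : set (dsumR R) :=
  [set x | (forall j, (j < n)%N -> exists z : int, x j = 2 ^+ k * z%:~R) /\
           (forall j, (n <= j)%N -> x j = 0)].

Definition gtilde_set {R : realType} (g : R -> nat) (r : R) : set nat :=
  [set k | (0 < k)%N /\ ad (lattice k (g r) : set (dsumR R)) r = (g r)%:R%:E].

(* The maximum of [gtilde_set g r], or 0 if that set is empty, which happens for
   r <= 2: then singletons have Lebesgue number 2^k >= r in (2^k Z)^n. *)
Definition gtilde {R : realType} (g : R -> nat) (r : R) : nat :=
  xget 0%N [set k | gtilde_set g r k /\
                    forall j, gtilde_set g r j -> (j <= k)%N].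

Definition Xomega {R : realType} (g : R -> nat) : metricType R :=
  asunion (fun i : nat => lattice (gtilde g i%:R) (g i%:R) : set (dsumR R)).

(* Main.v *)
Require Import Defs.
From mathcomp Require Import all_boot all_order all_algebra finmap.
From mathcomp Require Import all_classical all_reals all_analysis.
From mathcomp Require Import zify lra.

Set Implicit Arguments.
Unset Strict Implicit.
Unset Printing Implicit Defensive.

Import Order.TTheory GRing.Theory Num.Theory.
Import numFieldNormedType.Exports.

(** Both halves rest on one lower bound and one upper bound for lattices.

    Lower bound.  Label the points of a copy of the grid N^n of mesh [s] in such
    a way that points with a common label are at bounded distance.  Then some
    unit cell carries [n + 1] distinct labels ([distinct_labels_in_cell]); this is the Lebesgue covering theorem, obtained
    from Sperner's lemma for a triangulated cube.  If the label of a point is a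
    member of a bounded cover that contains the closed [s]-ball around the
    point, the [n + 1] members found share a point, so the multiplicity exceeds
    [n] ([grid_le_ad]).  If it is a pair (index i, member of the [i]-disjoint
    family), at most [n] indices, all at least [s], leave two labels with the
    same index and members that are too close; hence no such families exist
    ([grid_A_family]).

    Upper bound.  Cut R^m along slabs of width [r] orthogonal to the axes,
    periodically, and shift the slabs diagonally to get [m + 1] colours.  A point
    meets slabs of at most [m] colours, so it lies in a box of the remaining
    colour, and boxes of one colour are [r] apart ([slab_coloring]).  For
    lattices this gives asymptotic dimension function at most [m] at every scale
    ([ad_lattice_le]).  With the lower bound, the value of this function at [r]
    on (2^k Z)^n is [n] exactly when 2^k < r ([ad_lattice_eq]), so the step of
    each summand but the first is less than its index, and these steps tend to
    infinity.

    The inequality for the asymptotic dimension function follows: for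
    i < r <= i + 1 the summand of index [i + 1] is a lattice of dimension at
    least g(r) and of step less than [i + 1], hence at most [i] and less than
    [r].

    For the transfinite dimension, summands of large dimension put arbitrarily
    large finite sets in the family A(X), so its order is not finite.
    Conversely, fix [a].  The points in summands of index beyond 2^a are
    pairwise more than [a] apart, so one [a]-disjoint family of singletons
    covers them; the remaining summands all embed in one R^m up to a bounded
    error, so any [m + 1] further scales suffice for them, [m] being g(2^a).
    Thus the members of A(X)^a have at most [m] elements, its order is finite,
    and the order of A(X) is at most omega ([trasdim_Xomega]). *)

(** * Chains of tuples modulo 2 *)

Notation "\xor_ ( i <- r ) F" := (\big[addb/false]_(i <- r) F)
  (at level 36, F at level 36, i, r at level 50, format "\xor_ ( i  <-  r )  F").

Fixpoint faces (T : Type) (s : seq T) : seq (seq T) :=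
  if s is v :: s' then s' :: [seq v :: q | q <- faces s'] else [::].

(** The prism over the simplex [s] between its two copies [map lo s] and
    [map hi s], cut into simplices in the way that is usual in singular
    homology. *)
Fixpoint prism (T U : Type) (lo hi : T -> U) (s : seq T) : seq (seq U) :=
  if s is v :: s' then
    (lo v :: hi v :: map hi s') :: [seq lo v :: p | p <- prism lo hi s']
  else [::].

Lemma xor_faces_cons (T : Type) v (s : seq T) (F : seq T -> bool) :
  \xor_(q <- faces (v :: s)) F q = F s (+) \xor_(q <- faces s) F (v :: q).
Proof. by rewrite big_cons big_map. Qed.

Lemma xor_prism_cons (T U : Type) (lo hi : T -> U) v s (F : seq U -> bool) :
  \xor_(p <- prism lo hi (v :: s)) F p =
  F (lo v :: hi v :: map hi s) (+) \xor_(p <- prism lo hi s) F (lo v :: p).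
Proof. by rewrite big_cons big_map. Qed.

Lemma faces_map (T U : Type) (h : T -> U) s :
  faces (map h s) = map (map h) (faces s).
Proof. by elim: s => //= v s ->; rewrite -!map_comp. Qed.

(** The boundary of a prism is its top, its bottom and the prism over the
    boundary.  Chains modulo 2 are never formed: a chain is known through the
    sums over it of all functions [F]. *)
Lemma faces_prism (T U : Type) (lo hi : T -> U) (s : seq T)
    (F : seq U -> bool) :
  \xor_(p <- prism lo hi s) \xor_(q <- faces p) F q =
  F (map hi s) (+) F (map lo s) (+)
       \xor_(q <- faces s) \xor_(p <- prism lo hi q) F p.
Proof.
elim: s F => [|v s IH] F; first by rewrite !big_nil addbb.
rewrite xor_prism_cons.
under [X in _ (+) X = _]eq_bigr do rewrite xor_faces_cons.
rewrite big_split /= IH !xor_faces_cons faces_map !big_map.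
under [X in _ = _ (+) (_ (+) X)]eq_bigr do rewrite xor_prism_cons.
rewrite big_split /=.
move: (F _) (F _) (F _) => a b c.
move: (\big[_/_]_(_ <- _) _) (\big[_/_]_(_ <- _) _) (\big[_/_]_(_ <- _) _) => x y z.
by case: a b c x y z => [] [] [] [] [] [].
Qed.

(** Deleting the entry [a] from [s] leaves a permutation of [m] if and only if
    [s] is a permutation of [a :: m]; so the count of such faces does not depend
    on the order of [s]. *)
Lemma count_faces (T : eqType) (s m : seq T) :
  count (perm_eq m) (faces s) = count (fun a => perm_eq s (a :: m)) s.
Proof.
suff H (r : seq T) : count (fun q => perm_eq (r ++ q) m) (faces s) =
    count (fun a => perm_eq (r ++ s) (a :: m)) s.
  rewrite -(H [::]); apply: eq_count => q /=; exact: perm_sym.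
elim: s r => //= v s IH r; rewrite count_map; congr addn.
  by rewrite -cat1s perm_catCA cat1s perm_cons.
rewrite (eq_count (a2 := fun q => perm_eq ((rcons r v) ++ q) m)); last first.
  by move=> q /=; rewrite cat_rcons.
by rewrite IH; apply: eq_count => a /=; rewrite cat_rcons.
Qed.

Lemma xor_count (T : Type) (p : pred T) s : \xor_(x <- s) p x = odd (count p s).
Proof. by elim: s => [|x s IH]; rewrite ?big_nil ?big_cons //= IH oddD oddb. Qed.

(** The step of Sperner's argument: a simplex with all labels [0 .. k] has one
    face with all labels [0 .. k-1]; any other simplex with such a face has
    exactly two of them, since one of its labels is repeated. *)
Lemma odd_count_full_faces k (l : seq nat) : all (fun a => a <= k) l ->
  odd (count (perm_eq (iota 0 k)) (faces l)) = perm_eq l (iota 0 k.+1).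
Proof.
move=> lk; rewrite count_faces.
have [/hasP[a al pa]|/hasPn h] := boolP (has (fun a => perm_eq l (a :: iota 0 k)) l).
  have E b : perm_eq l (b :: iota 0 k) = (b == a).
    rewrite (permPl pa) -!(cat1s _ (iota 0 k)) perm_cat2r.
    by apply/idP/eqP => [/perm_small_eq-/(_ isT)[]|->].
  rewrite (eq_count (a2 := pred1 a)) // (permP pa) /= eqxx.
  rewrite count_uniq_mem ?iota_uniq// mem_iota /= add0n.
  have -> : perm_eq l (iota 0 k.+1) = (k == a).
    by rewrite -E -addn1 iotaD add0n -(cat1s k (iota 0 k)) !(perm_sym l) perm_catC.
  by move/allP: lk => /(_ a al); case: ltngtP.
rewrite (eq_in_count (a2 := pred0)) ?count_pred0 => [|a /h /negbTE //].
apply/esym/negbTE/negP => H.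
have kl : k \in l by rewrite (perm_mem H) mem_iota /=; lia.
have /negP[] := h _ kl.
by rewrite (perm_trans H)// -addn1 iotaD add0n /= perm_catC.
Qed.

(** * Sperner's lemma in a cube *)

(** A triangulation of the cube [0, N]^k, as an iterated prism.  A point is the
    sequence of its coordinates, and [rcons v t] puts [v] at height [t]; with
    default value [0], a sequence of length [k] also stands for the point of a
    higher-dimensional cube whose other coordinates vanish. *)
Fixpoint grid_chain (N k : nat) : seq (seq (seq nat)) :=
  if k is k'.+1 then
    flatten [seq prism (rcons^~ t) (rcons^~ t.+1) s |
              t <- iota 0 N, s <- grid_chain N k']
  else [:: [:: [::]]].

Lemma mem_prism (T U : eqType) (lo hi : T -> U) s p u :
  p \in prism lo hi s -> u \in p ->
  exists2 v, v \in s & u = lo v \/ u = hi v.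
Proof.
elim: s p => //= v s IH p; rewrite inE => /predU1P[->|/mapP[q qs ->]].
  rewrite !inE => /or3P[/eqP ->|/eqP ->|/mapP[w ws ->]].
  - by exists v; rewrite ?mem_head//; left.
  - by exists v; rewrite ?mem_head//; right.
  - by exists w; rewrite ?in_cons ?ws ?orbT//; right.
rewrite inE => /predU1P[->|/(IH _ qs)[w ws uw]].
  by exists v; rewrite ?mem_head//; left.
by exists w; rewrite ?in_cons ?ws ?orbT.
Qed.

Lemma size_prism (T U : eqType) (lo hi : T -> U) s p :
  p \in prism lo hi s -> size p = (size s).+1.
Proof.
elim: s p => //= v s IH p; rewrite inE => /predU1P[->|/mapP[q qs ->]] /=.
  by rewrite size_map.
by rewrite (IH q).
Qed.

Lemma grid_chainP N k s : s \in grid_chain N k ->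
  [/\ size s = k.+1, (forall v, v \in s -> size v = k) &
   (forall v w j, v \in s -> w \in s -> nth 0 v j <= (nth 0 w j).+1)].
Proof.
elim: k s => [|k IH] s.
  rewrite inE => /eqP ->; split=> // v; first by rewrite inE => /eqP ->.
  by move=> w j; rewrite !inE => /eqP -> /eqP ->; rewrite nth_nil.
case/flattenP => _ /allpairsP[[t s'] /= [_ /IH[szs szv close] ->]] sp.
split; first by rewrite (size_prism sp) szs.
  by move=> v /(mem_prism sp)[w /szv <-] [] ->; rewrite size_rcons.
move=> v w j /(mem_prism sp)[v' vs hv] /(mem_prism sp)[w' ws hw].
have := close v' w' j vs ws; move: (szv _ vs) (szv _ ws) => szv' szw'.
by case: hv hw => -> [] ->; rewrite !nth_rcons szv' szw'; case: ltngtP => //; lia.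
Qed.

(** Adjacent prisms share a horizontal side, so only the sides at heights [0]
    and [N] survive. *)
Lemma xor_faces_grid_chain N k (F : seq (seq nat) -> bool) :
  \xor_(s <- grid_chain N k.+1) \xor_(q <- faces s) F q =
  (\xor_(s <- grid_chain N k) F (map (rcons^~ N) s)) (+)
  (\xor_(s <- grid_chain N k) F (map (rcons^~ 0) s)) (+)
  \xor_(t <- iota 0 N) \xor_(s <- grid_chain N k) \xor_(q <- faces s)
    \xor_(p <- prism (rcons^~ t) (rcons^~ t.+1) q) F p.
Proof.
rewrite /= big_flatten /= big_allpairs_dep /=.
under eq_bigr => t _ do
  (under eq_bigr => s _ do rewrite faces_prism; rewrite big_split /=).
rewrite big_split /=; congr (_ (+) _).
elim: N (grid_chain N k) => [|N IH] c.
  by rewrite big_nil addbb.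
rewrite -[in iota 0 _]addn1 iotaD add0n big_cat /= big_seq1 IH big_split /=.
move: (\big[_/_]_(_ <- _) _) (\big[_/_]_(_ <- _) _) (\big[_/_]_(_ <- _) _) => x y z.
by case: x y z => [] [] [].
Qed.

(** The boundary of the triangulated cube lies in the faces of the cube.  For
    [k = 0] it consists of the empty tuple. *)
Lemma xor_boundary_grid_chain N k (G : seq (seq nat) -> bool) :
  G [::] = false ->
  (forall q j e, j < k -> e = 0 \/ e = N ->
     (forall v, v \in q -> size v = k /\ nth 0 v j = e) -> G q = false) ->
  \xor_(s <- grid_chain N k) \xor_(q <- faces s) G q = false.
Proof.
elim: k G => [|k IH] G G0 GS; first by rewrite !big_seq1.
have top e : e = 0 \/ e = N ->
    \xor_(s <- grid_chain N k) G (map (rcons^~ e) s) = false.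
  move=> he; rewrite big_seq big1// => s /grid_chainP[_ sz _].
  apply: (GS _ k e) => // _ /mapP[v /sz sv ->].
  by rewrite size_rcons nth_rcons sv ltnn eqxx.
rewrite xor_faces_grid_chain !top; [|by left|by right].
rewrite big1// => t _; apply: IH => [|q j e jk he qe]; first by rewrite big_nil.
rewrite big_seq big1// => p pq; apply: (GS _ j e) => // [|v /(mem_prism pq)[w]].
  exact: ltnW.
by case/qe => sw we [] ->; rewrite size_rcons nth_rcons sw jk.
Qed.

(** The boundary conditions of Sperner's lemma for a cube.  As missing
    coordinates count as [0], the second one also bounds the label of a point by
    the length of the point, that is, by the dimension of the cube in which it
    lies. *)
Section Sperner.
Variables (n N : nat) (lab : seq nat -> nat).
Hypothesis lab_rcons0 : forall v, size v < n -> lab (rcons v 0) = lab v.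
Hypothesis lab_le : forall v j, size v <= n -> nth 0 v j = 0 -> lab v <= j.
Hypothesis lab_neq : forall v j, size v <= n -> nth 0 v j = N -> lab v <> j.

(** Counting the fully labelled simplices of the [k.+1]-cube through their faces
    leaves a sum over the boundary of the cube.  Only the bottom, where
    coordinate [k] is [0], can carry all labels [0 .. k]: another face with a
    vanishing coordinate [j] has labels at most [j], and the face where
    coordinate [j] is [N] misses [j].  The bottom is the [k]-cube. *)
Lemma odd_full_grid_chain k : k <= n ->
  \xor_(s <- grid_chain N k) perm_eq (iota 0 k.+1) (map lab s) = true.
Proof.
elim: k => [_|k IH kn].
  rewrite big_seq1 /=; have -> : lab [::] = 0; last by [].
  by apply/eqP; rewrite -leqn0 lab_le.
set F := fun q : seq (seq nat) => perm_eq (iota 0 k.+1) (map lab q).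
have Fmiss q j : j <= k -> (forall v, v \in q -> lab v <> j) -> F q = false.
  move=> jk hq; apply/negP => /perm_mem/(_ j); rewrite mem_iota /= add0n ltnS jk.
  by move/esym/mapP => [v /hq + /esym].
transitivity (\xor_(s <- grid_chain N k.+1) \xor_(q <- faces s) F q).
  apply: eq_big_seq => s /grid_chainP[_ sz _].
  rewrite xor_count perm_sym -odd_count_full_faces; last first.
    apply/allP => _ /mapP[v /sz sv ->].
    by rewrite lab_le// ?nth_default// sv.
  by rewrite faces_map count_map.
rewrite xor_faces_grid_chain.
have -> : \xor_(s <- grid_chain N k) F (map (rcons^~ N) s) = false.
  rewrite big_seq big1// => s /grid_chainP[_ sz _].
  apply: (Fmiss _ k) => // _ /mapP[v vs ->].
  apply: lab_neq; first by rewrite size_rcons (sz v vs).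
  by rewrite nth_rcons (sz v vs) ltnn eqxx.
have -> : \xor_(s <- grid_chain N k) F (map (rcons^~ 0) s) = true.
  rewrite -[RHS](IH (ltnW kn)); apply: eq_big_seq => s /grid_chainP[_ sz _].
  rewrite /F -map_comp.
  by congr perm_eq; apply/eq_in_map => v /sz sv /=; rewrite lab_rcons0 ?sv.
rewrite big1// => t _; apply: xor_boundary_grid_chain => [|q j e jk he qe].
  by rewrite big_nil.
rewrite big_seq big1// => p pq.
have pe v : v \in p -> size v <= n /\ nth 0 v j = e.
  move=> /(mem_prism pq)[w /qe[sw we]].
  by case=> ->; rewrite size_rcons nth_rcons sw jk.
case: he => eE; [apply: (Fmiss _ k) | apply: (Fmiss _ j) => [|v /pe]] => //.
- move=> v /pe; rewrite eE => -[sv vj] vk.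
  by have := lab_le sv vj; rewrite vk leqNgt jk.
- exact: ltnW.
- by rewrite eE => -[]; exact: lab_neq.
Qed.

Lemma exists_full_cell : exists s : seq (seq nat),
  [/\ size s = n.+1, (forall v, v \in s -> size v = n),
      (forall v w j, v \in s -> w \in s -> nth 0 v j <= (nth 0 w j).+1) &
      uniq (map lab s)].
Proof.
have /hasP[s /grid_chainP[? ? ?] full] :
    has (fun s => perm_eq (iota 0 n.+1) (map lab s)) (grid_chain N n).
  rewrite has_count lt0n; apply/eqP => c0.
  by have := odd_full_grid_chain (leqnn n); rewrite xor_count c0.
by exists s; split=> //; rewrite -(perm_uniq full) iota_uniq.
Qed.
End Sperner.

(** If no value of [f] is taken on two opposite faces of the cube of side [N],
    label [v] by the first coordinate [j] such that [f v] is not a value of [f]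
    on the face where coordinate [j] is [N].  This is a labelling as in Sperner's
    lemma, and it factors through [f]. *)
Lemma distinct_labels_in_cell (T : Type) (n N : nat) (f : seq nat -> T) :
  (forall v, (size v < n)%N -> f (rcons v 0%N) = f v) ->
  (forall v w j, (size v <= n)%N -> (size w <= n)%N ->
     nth 0%N v j = 0%N -> nth 0%N w j = N -> f v <> f w) ->
  exists s : seq (seq nat),
  [/\ size s = n.+1, uniq s, (forall v, v \in s -> size v = n),
      (forall v w j, v \in s -> w \in s -> (nth 0%N v j <= (nth 0%N w j).+1)%N) &
      {in s &, injective f}].
Proof.
move=> f0 fN.
pose P v j := ~~ `[< exists w, [/\ (size w <= n)%N, nth 0%N w j = N & f w = f v] >].
have P0 v j : (size v <= n)%N -> nth 0%N v j = 0%N -> P v j.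
  by move=> sv vj; apply/asboolPn => -[w [sw wj /esym]]; exact: fN vj wj.
(* The bound [n] makes the minimum exist outside the cube as well. *)
have exP v : exists j, P v j || (n <= j)%N by exists n; rewrite leqnn orbT.
pose lab v := ex_minn (exP v).
have labE v w : f v = f w -> lab v = lab w.
  move=> vw; have PE j : P v j = P w j by rewrite /P vw.
  rewrite /lab; case: ex_minnP => i Pi mi; case: ex_minnP => j Pj mj.
  by apply/eqP; rewrite eqn_leq mi ?PE// mj// -PE.
have [|v j sv vj|v j sv vj|s [? sz ? ul]] := @exists_full_cell n N lab.
- by move=> v sv; apply: labE; exact: f0.
- by rewrite /lab; case: ex_minnP => i _; apply; rewrite P0.
- rewrite /lab; case: ex_minnP => i + _ => /orP[/asboolPn Pi ij|ni ij]; subst i.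
    by apply: Pi; exists v.
  by apply: (fN v v j) => //; rewrite nth_default// (leq_trans sv).
exists s; split => //; first exact: map_uniq ul.
move=> v w vs ws /labE vw.
rewrite -(nth_index [::] vs) -(nth_index [::] ws); congr nth.
apply/eqP; rewrite -(nth_uniq 0%N _ _ ul) ?size_map ?index_mem//.
by rewrite !(nth_map [::]) ?index_mem// !nth_index// vw.
Qed.

Local Open Scope classical_set_scope.
Local Open Scope ring_scope.

(** * Families of subsets of a metric space *)

Section families.
Context {R : realType} {X : metricType R}.
Implicit Types (U V : set X) (F : set (set X)) (r : R).

Lemma uniformly_boundedP F : uniformly_bounded F <->
  exists D : R, forall U, F U -> forall x y, U x -> U y -> mdist x y <= D.
Proof.
split=> [bF|[D FD]].
  have [D FD] : exists D : R, forall U, F U -> (diam U <= D%:E)%E.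
    have FS U : F U -> (diam U <= ereal_sup [set diam U | U in F])%E.
      by move=> FU; apply: ereal_sup_ubound; exists U.
    move: bF FS; rewrite /uniformly_bounded; case: ereal_sup => [D| |] //.
      by move=> _ FS; exists D.
    by move=> _ FS; exists 0 => U /FS; rewrite leeNy_eq => /eqP ->; rewrite leNye.
  exists D => U /FD UD x y Ux Uy; rewrite -lee_fin (le_trans _ UD)//.
  by apply: ereal_sup_ubound; exists x => //; exists y.
apply: (@le_lt_trans _ _ D%:E); last exact: ltry.
apply: ge_ereal_sup => _ [U FU <-]; apply: ge_ereal_sup => _ [x Ux [y Uy <-]].
by rewrite lee_fin; exact: FD Ux Uy.
Qed.

Lemma r_disjoint_lt r F U V x y : r_disjoint r F -> F U -> F V -> U <> V ->
  U x -> V y -> r < mdist x y.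
Proof.
move=> dF FU FV UV Ux Vy; rewrite -lte_fin (lt_le_trans (dF _ _ FU FV UV))//.
by apply: ereal_inf_lbound; exists x => //; exists y.
Qed.

Lemma r_disjoint_gap r r' F : r < r' ->
  (forall U V x y, F U -> F V -> U <> V -> U x -> V y -> r' <= mdist x y) ->
  r_disjoint r F.
Proof.
move=> rr' dF U V FU FV UV; apply: (@lt_le_trans _ _ r'%:E); first by rewrite lte_fin.
by apply: le_ereal_inf_tmp => _ [x Ux [y Vy <-]]; rewrite lee_fin; exact: dF Ux Vy.
Qed.

Lemma Lebesgue_number_gt r s F x : s < r -> (r%:E <= Lebesgue_number F)%E ->
  exists2 U, F U & forall y, mdist x y <= s -> U y.
Proof.
move=> sr /(lt_le_trans _) rF.
have {}/rF : (s%:E < r%:E)%E by rewrite lte_fin.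
move=> /lt_le_trans /(_ (ereal_inf_lbound _)) H.
have /H : [set ereal_sup [set r%:E | r in
    [set r | 0 < r /\ exists2 U, F U & ball x r `<=` U]] | x in [set: X]]
    (ereal_sup [set r%:E | r in
    [set r | 0 < r /\ exists2 U, F U & ball x r `<=` U]]) by exists x.
move=> /ereal_sup_gt[_ [t [t0 [U FU xU]] <-]]; rewrite lte_fin => st.
exists U => // y xy; apply: xU; rewrite ballEmdist /=.
exact: le_lt_trans st.
Qed.

Lemma le_Lebesgue_number r F : 0 < r ->
  (forall x, exists2 U, F U & ball x r `<=` U) -> (r%:E <= Lebesgue_number F)%E.
Proof.
move=> r0 FU; apply: le_ereal_inf_tmp => _ [x _ <-].
by apply: ereal_sup_ubound; exists r.
Qed.

Lemma le_ad n r :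
  (forall F, uniformly_bounded F -> (r%:E <= Lebesgue_number F)%E ->
    exists G, [/\ G `<=` F, (G #= `I_n.+1)%card & \bigcap_(U in G) U !=set0]) ->
  (n%:R%:E <= ad X r)%E.
Proof.
move=> H; rewrite /ad leeBrDr// -EFinD natr1.
apply: le_ereal_inf_tmp => _ [F [bF _ LF] <-].
by have [G HG] := H F bF LF; apply: ereal_sup_ubound; exists n.+1 => //; exists G.
Qed.

(** A cover by sets [U x] coloured with [n + 1] colours such that distinct sets
    of one colour are disjoint: a point lies in at most one set of each
    colour. *)
Lemma ad_le n (r : R) (D : R) (c : X -> nat) (U : X -> set X) : 0 < r ->
  (forall x, (c x <= n)%N) ->
  (forall x, ball x r `<=` U x) ->
  (forall x y z, U x y -> U x z -> mdist y z <= D) ->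
  (forall x y, c x = c y -> U x `&` U y !=set0 -> U x = U y) ->
  (ad X r <= n%:R%:E)%E.
Proof.
move=> r0 cn xU UD cU; rewrite /ad leeBlDr// -EFinD natr1.
apply: (@le_trans _ _ (multiplicity (range U))).
  apply: ereal_inf_lbound; exists (range U) => //; split.
  - by apply/uniformly_boundedP; exists D => _ [x _ <-]; exact: UD.
  - apply/seteqP; split=> // x _; exists (U x); first by exists x.
    exact/xU/ballxx.
  - by apply: le_Lebesgue_number => // x; exists (U x); first exists x.
apply: ge_ereal_sup => _ [k [G [GU Gk [p pG]]] <-].
rewrite lee_fin ler_nat.
have [x xP] : {x : set X -> X & forall V, G V -> V = U (x V)}.
  apply: (@choice _ _ (fun V x => G V -> V = U x)) => V.
  by have [/GU[x _ <-]|nG] := pselect (G V); [exists x|exists p].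
have xin : {in G &, injective (c \o x)}.
  move=> V W; rewrite !inE => GV GW /= cVW; rewrite (xP _ GV) (xP _ GW).
  by apply: cU => //; exists p; rewrite -!xP//; split; exact: pG.
rewrite -card_le_II -(card_le_eql Gk) -(card_le_eql (inj_card_eq xin)).
by apply: subset_card_le => _ [V GV <-] /=; rewrite ltnS.
Qed.

End families.

(** * Lower bounds from grids *)

Section grids.
Context {R : realType}.

(** A copy of the grid N^n with mesh [s].  Only the two estimates that the
    labelling argument uses are required: the points of a unit cell are within
    [s] of each other, and coordinates are controlled by the distance.  The first
    condition is the convention on missing coordinates for points of length less
    than [n]. *)
Definition grid_embedding (X : metricType R) (n : nat) (s : R)
    (e : seq nat -> X) : Prop :=
  [/\ (forall v, (size v < n)%N -> e (rcons v 0%N) = e v),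
      (forall v w, size v = n -> size w = n ->
         (forall j, (nth 0%N v j <= (nth 0%N w j).+1)%N) ->
         (forall j, (nth 0%N w j <= (nth 0%N v j).+1)%N) ->
         mdist (e v) (e w) <= s) &
      (forall v w j, (size v <= n)%N -> (size w <= n)%N -> (j < n)%N ->
         s * `|(nth 0%N v j)%:R - (nth 0%N w j)%:R| <= mdist (e v) (e w))].

(** Labels with fibres of diameter at most [D] do not meet opposite faces of a
    cube whose side [N] satisfies D < s * N. *)
Lemma distinct_labels_close (X : metricType R) n s e (T : Type) (f : X -> T) D :
  0 < s -> @grid_embedding X n s e ->
  (forall x y, f x = f y -> mdist x y <= D) ->
  exists y : nat -> X,
    (forall i j, (i <= n)%N -> (j <= n)%N -> mdist (y i) (y j) <= s) /\
    (forall i j, (i <= n)%N -> (j <= n)%N -> f (y i) = f (y j) -> i = j).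
Proof.
move=> s0 [e0 es eD] fD.
set N := (Num.truncn (D / s)).+1.
have NP : D < s * N%:R by rewrite mulrC -ltr_pdivrMr// real_truncnS_gt// num_real.
have [v vn|v w j vn wn vj wj vw|t [tn ut tv tvw finj]] :=
    @distinct_labels_in_cell T n N (f \o e).
- by rewrite /= e0.
- have jn : (j < n)%N.
    rewrite ltnNge; apply/negP => nj.
    by move: wj; rewrite nth_default// (leq_trans wn).
  have := le_trans (eD v w j vn wn jn) (fD _ _ vw).
  by rewrite vj wj sub0r normrN normr_nat leNgt NP.
have tP i : (i <= n)%N -> nth [::] t i \in t by move=> ni; rewrite mem_nth// tn.
exists (fun i => e (nth [::] t i)); split=> i j ni nj.
  by apply: es => [||k|k]; [exact/tv/tP|exact/tv/tP|apply: tvw; exact: tP..].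
move=> /(finj _ _ (tP _ ni) (tP _ nj))/eqP; rewrite nth_uniq ?tn// => /eqP //.
Qed.

(** Label a point by a member of the cover that contains the closed [s]-ball
    around it: the members that label the points of one cell all contain each
    point of that cell. *)
Lemma grid_le_ad (X : metricType R) n s e r :
  0 < s -> s < r -> @grid_embedding X n s e -> (n%:R%:E <= ad X r)%E.
Proof.
move=> s0 sr he; apply: le_ad => F /uniformly_boundedP[D FD] LF.
have [f fP] : {f : X -> set X & forall x, F (f x) /\
    forall y, mdist x y <= s -> f x y}.
  apply: (@choice _ _ (fun x U => F U /\ forall y, mdist x y <= s -> U y)) => x.
  by have [U FU xU] := Lebesgue_number_gt x sr LF; exists U.
have fxx x : f x x by apply: (fP x).2; rewrite mdistxx ltW.
have [x y xy|y [ys yinj]] := @distinct_labels_close X n s e _ f D s0 he.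
  by apply: (FD (f x)) => //; [exact: (fP x).1|rewrite xy].
exists ((f \o y) @` `I_n.+1); split.
- by move=> _ [i _ <-]; exact: (fP _).1.
- by apply: inj_card_eq => i j; rewrite !inE /= !ltnS; exact: yinj.
- by exists (y 0%N) => _ [i /= + <-]; rewrite ltnS => ni; apply: (fP _).2; exact: ys.
Qed.

(** Label a point by a member of one of the families that contains it.  In a cell
    with [n + 1] labels, two members come from the same [i]-disjoint family
    although they are within [s <= i] of each other. *)
Lemma grid_A_family (X : metricType R) n s e (t : {fset nat}) :
  0 < s -> @grid_embedding X n s e -> FinN t -> (#|` t| <= n)%N ->
  (forall i, i \in t -> s <= i%:R) -> A_family X t.
Proof.
move=> s0 he tF tn st; split=> // -[F [FP /seteqP[_ Fcov]]].
have [D DP] : exists D : R, forall i, i \in t -> forall U, F i U ->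
    forall x y, U x -> U y -> mdist x y <= D.
  have /choice[D DP] i : exists D : R, i \in t -> forall U, F i U ->
      forall x y, U x -> U y -> mdist x y <= D.
    have [it|_] := boolP (i \in t); last by exists 0.
    by have /uniformly_boundedP[D ?] := (FP i it).1; exists D.
  exists (\big[Order.max/0]_(i <- t) D i) => i it U FU x y Ux Uy.
  apply: le_trans (DP i it U FU x y Ux Uy) _.
  exact: (@le_bigmax_seq _ _ _ _ _ _ xpredT D).
have [f fP] : {f : X -> nat * set X & forall x,
    [/\ (f x).1 \in t, F (f x).1 (f x).2 & (f x).2 x]}.
  apply: (@choice _ _ (fun x u => [/\ u.1 \in t, F u.1 u.2 & u.2 x])) => x.
  by have [U [i it FU] Ux] := Fcov x I; exists (i, U).
have [x y xy|y [ys yinj]] := @distinct_labels_close X n s e _ f D s0 he.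
  have [fxt Ff fxx] := fP x; apply: DP Ff _ _ fxx _ => //.
  by rewrite xy; have [] := fP y.
have : {in iota 0 n.+1 &, injective (fun i => (f (y i)).1)}.
  move=> i j; rewrite !mem_iota !add0n !ltnS /= => ni nj fij.
  apply/eqP/negPn/negP => /eqP ij.
  have [it Fi fi] := fP (y i); have [jt Fj fj] := fP (y j).
  have : (f (y i)).2 <> (f (y j)).2.
    move=> f2; apply/ij/yinj => //.
    by rewrite [f (y i)]surjective_pairing fij f2 -surjective_pairing.
  rewrite -fij in Fj * => /(r_disjoint_lt (FP _ it).2 Fi Fj)/(_ fi fj).
  by apply/negP; rewrite -leNgt (le_trans (ys _ _ ni nj))// st.
move=> /map_inj_in_uniq; rewrite iota_uniq => /(uniq_leq_size (s2 := t)).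
rewrite size_map size_iota ltnNge tn => H; apply/notF/H.
by move=> _ /mapP[j _ ->]; have [] := fP (y j).
Qed.
End grids.

(** * Finitely supported sequences, lattices and asymptotic unions *)

Section spaces.
Context {R : realType}.

Lemma dsumR_distE (x y : dsumR R) :
  mdist x y = \big[Num.max/0]_(j <- (finsupp x `|` finsupp y)%fset) `|x j - y j|.
Proof. by []. Qed.

Lemma le_dsumR_dist (x y : dsumR R) j : `|x j - y j| <= mdist x y.
Proof.
rewrite dsumR_distE.
have [jxy|] := boolP (j \in (finsupp x `|` finsupp y)%fset).
  exact: (@le_bigmax_seq _ _ _ _ _ _ xpredT (fun j => `|x j - y j|)).
rewrite in_fsetU negb_or => /andP[jx jy].
by rewrite !fsfun_dflt// subr0 normr0 bigmax_ge_id.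
Qed.

Lemma dsumR_dist_le (x y : dsumR R) c :
  0 <= c -> (forall j, `|x j - y j| <= c) -> mdist x y <= c.
Proof. by move=> c0 h; rewrite dsumR_distE; apply: bigmax_le. Qed.

Lemma subspace_distE (X : metricType R) (A : set X) (x y : A) :
  mdist x y = mdist (\val x) (\val y).
Proof. by []. Qed.

Section asunion.
Context {Z : metricType R} (Z_ : nat -> set Z).

Definition aspoint (x : asunion Z_) : Z := \val (tagged x).

Definition asgap (l k : nat) : R := \sum_(minn l k <= j < maxn l k) j%:R.

Lemma asunion_distE (x y : asunion Z_) :
  mdist x y = mdist (aspoint x) (aspoint y) + asgap (tag x).+1 (tag y).+1.
Proof. by []. Qed.

Lemma asgap_ge0 l k : 0 <= asgap l k. Proof. exact: sumr_ge0. Qed.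

Lemma asgap_gt l k : l <> k -> (minn l k)%:R <= asgap l k.
Proof.
move=> lk; rewrite /asgap big_ltn; last by lia.
by rewrite lerDl sumr_ge0.
Qed.

Lemma asgap_le l k m : (l <= m)%N -> (k <= m)%N ->
  asgap l k <= \sum_(0 <= j < m) j%:R.
Proof.
move=> lm km; rewrite /asgap (@big_cat_nat _ _ _ (minn l k) 0 m) //=; last by lia.
rewrite (@big_cat_nat _ _ _ (maxn l k) _ m) //=; try lia.
by rewrite addrCA lerDl addr_ge0// sumr_ge0.
Qed.

Definition summand i (z : Z_ i.+1) : asunion Z_ := existT _ i z.

Lemma summand_dist i (z z' : Z_ i.+1) : mdist (summand z) (summand z') = mdist z z'.
Proof.
rewrite asunion_distE subspace_distE /asgap minnn maxnn big_geq//.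
by rewrite addr0.
Qed.

Lemma summand_grid i n s (e : seq nat -> Z_ i.+1) :
  @grid_embedding R (Z_ i.+1) n s e ->
  @grid_embedding R (asunion Z_) n s (@summand i \o e).
Proof.
move=> [e0 es eD]; split.
- by move=> v /e0 /= ->.
- by move=> v w vn wn vw wv; rewrite /= summand_dist; exact: es.
- by move=> v w j vn wn jn; rewrite /= summand_dist; exact: eD.
Qed.
End asunion.

Definition lattice_fun (k n : nat) (v : seq nat) : dsumR R :=
  [fsfun j in seq_fset tt (iota 0 n) => 2 ^+ k * (nth 0%N v j)%:R].

Lemma lattice_funE k n v j :
  lattice_fun k n v j = if (j < n)%N then 2 ^+ k * (nth 0%N v j)%:R else 0.
Proof. by rewrite /lattice_fun fsfun_fun seq_fsetE mem_iota add0n. Qed.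

Lemma lattice_fun_in k n v : lattice k n (lattice_fun k n v).
Proof.
split=> j jn; rewrite lattice_funE.
  by rewrite jn; exists (nth 0%N v j)%:Z.
by rewrite ltnNge jn.
Qed.

Definition lattice_point k n v : (lattice k n : set (dsumR R)) :=
  SigSub (mem_set (lattice_fun_in k n v)).

Lemma lattice_grid k n :
  @grid_embedding R (lattice k n : set (dsumR R)) n (2 ^+ k) (lattice_point k n).
Proof.
split.
- move=> v vn; apply: val_inj; apply/fsfunP => j /=; rewrite !lattice_funE nth_rcons.
  case: (ltngtP j (size v)) => // vj.
    by rewrite nth_default// ltnW.
  by rewrite nth_default// vj.
- move=> v w vn wn vw wv; rewrite subspace_distE /=.
  apply: dsumR_dist_le => [|j]; first exact: exprn_ge0.
  rewrite !lattice_funE; case: ifP => jn; last by rewrite subrr normr0 exprn_ge0.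
  rewrite -mulrBr normrM ger0_norm ?exprn_ge0// ler_piMr ?exprn_ge0//.
  have := vw j; have := wv j; rewrite -!(ler_nat R) -!natr1 ler_norml; lra.
- move=> v w j vn wn jn; rewrite subspace_distE /=.
  apply: le_trans (le_dsumR_dist _ _ j).
  by rewrite !lattice_funE jn -mulrBr normrM (@ger0_norm _ (2 ^+ k)) ?exprn_ge0.
Qed.

Lemma lattice_dist_ge k n (x y : (lattice k n : set (dsumR R))) :
  x <> y -> 2 ^+ k <= mdist x y.
Proof.
move=> xy; rewrite subspace_distE; have [x1 x2] := set_valP x; have [y1 y2] := set_valP y.
have [[j xyj]|nj] :=
    pselect (exists j, (val x : dsumR R) j <> (val y : dsumR R) j); last first.
  exfalso; apply/xy/val_inj/fsfunP => j.
  by apply: contrapT => xyj; apply: nj; exists j.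
apply: le_trans (le_dsumR_dist _ _ j).
have jn : (j < n)%N.
  by rewrite ltnNge; apply/negP => nj; apply: xyj; rewrite x2 ?y2.
have [z zx] := x1 j jn; have [w wy] := y1 j jn.
rewrite zx wy -mulrBr normrM (@ger0_norm _ (2 ^+ k)) ?exprn_ge0// ler_peMr ?exprn_ge0//.
rewrite -intrB -intr_norm ler1z -gtz0_ge1 normr_gt0 subr_eq0.
by apply/eqP => zw; apply: xyj; rewrite zx wy zw.
Qed.

End spaces.

(** * Coloured boxes in Euclidean space *)

Lemma missing_color (m : nat) (s : seq nat) : (size s <= m)%N ->
  exists2 i, (i <= m)%N & i \notin s.
Proof.
move=> sm; have /allPn[i] : ~~ all (mem s) (iota 0 m.+1).
  apply/negP => /allP /(uniq_leq_size (iota_uniq 0 m.+1)).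
  by rewrite size_iota ltnNge sm.
by rewrite mem_iota add0n ltnS => im; exists i.
Qed.

(** Slabs of colour [i] are the unit intervals whose number is congruent to [i]
    modulo [M].  Intervals outside these slabs, but in different cells between
    them, are separated by a whole slab. *)
Lemma slab_gap (M : nat) (i u v : int) : (0 < M)%N ->
  (v != i %[mod M])%Z -> ((u - i) %/ M)%Z < ((v - i) %/ M)%Z -> u + 1 < v.
Proof.
move=> M0 vi uv.
have Mn : (M : int) != 0 by lia.
have v0 : ((v - i) %% M)%Z != 0.
  by apply: contraNneq vi => /dvdz_mod0P; rewrite eqz_mod_dvd.
have := ltz_pmod (u - i) (d := M); have := modz_ge0 (v - i) Mn.
have := divz_eq (u - i) M; have := divz_eq (v - i) M.
move: uv v0; move: ((u - i) %/ M)%Z ((v - i) %/ M)%Z => a b ab.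
move: ((u - i) %% M)%Z ((v - i) %% M)%Z => c d d0 vE uE dge cM.
have : (a + 1) * M%:Z <= b * M%:Z by rewrite ler_pM2r; lia.
lia.
Qed.

Lemma slab_cell (M : nat) (i u v : int) : (0 < M)%N ->
  ((u - i) %/ M)%Z = ((v - i) %/ M)%Z -> `|u - v| <= M%:Z.
Proof.
move=> M0.
have Mn : (M : int) != 0 by lia.
have := divz_eq (u - i) M; have := divz_eq (v - i) M.
have := modz_ge0 (v - i) Mn; have := modz_ge0 (u - i) Mn.
have := ltz_pmod (v - i) (d := M); have := ltz_pmod (u - i) (d := M).
move: ((u - i) %/ M)%Z ((v - i) %/ M)%Z => a b.
move: ((u - i) %% M)%Z ((v - i) %% M)%Z => c d + + + + + + ab.
rewrite ab; lia.
Qed.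

(** [phi] gives [m] coordinates, which determine distances on [P] up to the
    additive constant [C].  The colour [c x] is chosen so that no coordinate of
    [x] lies in a slab of this colour, and [q x] names the box of [x] between the
    slabs. *)
Lemma slab_coloring {R : realType} (X : metricType R) (P : set X) (m : nat)
    (phi : X -> nat -> R) (C r : R) : 0 < r ->
  (forall x y j, (j < m)%N -> `|phi x j - phi y j| <= mdist x y) ->
  (forall x y (B : R), P x -> P y -> 0 <= B ->
     (forall j, (j < m)%N -> `|phi x j - phi y j| <= B) -> mdist x y <= B + C) ->
  exists D (c : X -> nat) (q : X -> seq int),
    [/\ forall x, (c x <= m)%N,
        forall x y, P x -> P y -> c x = c y -> q x = q y -> mdist x y <= D &
        forall x y, c x = c y -> q x <> q y -> r <= mdist x y].
Proof.
move=> r0 phi_le le_phi.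
(* [u x j] is the number of the interval of length [r] that contains [phi x j]. *)
pose u x j := Num.floor (phi x j / r).
have ule x j : (u x j)%:~R * r <= phi x j by rewrite -ler_pdivlMr// floor_le.
have ult x j : phi x j < ((u x j)%:~R + 1) * r.
  by rewrite -ltr_pdivrMr// -[1]/(1%:~R) -intrD floorD1_gt.
have [c cP] : {c : X -> nat & forall x, (c x <= m)%N /\
    forall j, (j < m)%N -> (u x j != (c x)%:Z %[mod m.+1])%Z}.
  apply: (@choice _ _ (fun x i => (i <= m)%N /\
    forall j, (j < m)%N -> (u x j != i%:Z %[mod m.+1])%Z)) => x.
  have [|i im ni] := @missing_color m (mkseq (fun j => `|(u x j %% m.+1)%Z|%N) m).
    by rewrite size_mkseq.
  exists i; split=> // j jm; apply: contra ni => /eqP uij.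
  apply/mapP; exists j; first by rewrite mem_iota.
  by rewrite uij modz_nat absz_nat modn_small.
pose q x := mkseq (fun j => ((u x j - (c x)%:Z) %/ m.+1)%Z) m.
exists ((m.+2)%:R * r + C), c, q; split=> [x|x y Px Py cxy qxy|x y cxy qxy].
- exact: (cP x).1.
- apply: le_phi => // [|j jm]; first by rewrite mulr_ge0 ?ltW.
  have /slab_cell : ((u x j - (c x)%:Z) %/ m.+1)%Z = ((u y j - (c x)%:Z) %/ m.+1)%Z.
    by have := congr1 (nth 0 ^~ j) qxy; rewrite !nth_mkseq// -cxy.
  move=> /(_ isT); rewrite -(ler_int R) intr_norm intrB => uxy.
  have := ule x j; have := ule y j; have := ult x j; have := ult y j.
  move: uxy; rewrite ler_norml ler_norml -[m.+2]addn1 natrD => /andP[u1 u2].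
  nra.
- have [j jm uq] : exists2 j, (j < m)%N &
      ((u x j - (c x)%:Z) %/ m.+1)%Z <> ((u y j - (c x)%:Z) %/ m.+1)%Z.
    apply: contrapT => nj; apply: qxy; apply: (@eq_from_nth _ 0).
      by rewrite !size_mkseq.
    move=> j; rewrite size_mkseq => jm; rewrite !nth_mkseq// -cxy.
    by apply: contrapT => uq; apply: nj; exists j.
  apply: le_trans (phi_le x y j jm).
  have gap a b : c a = c x -> c b = c x ->
      ((u a j - (c x)%:Z) %/ m.+1)%Z < ((u b j - (c x)%:Z) %/ m.+1)%Z ->
      r <= phi b j - phi a j.
    move=> ca cb ab; have := @slab_gap m.+1 _ _ _ isT _ ab.
    rewrite -{1}cb => /(_ ((cP b).2 j jm)).
    rewrite -lezD1 -(ler_int R) !intrD /= => uab.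
    have := ult a j; have := ule b j; nra.
  have [/gap H|/gap H|//] := ltgtP ((u x j - (c x)%:Z) %/ m.+1)%Z
      ((u y j - (c x)%:Z) %/ m.+1)%Z.
    by rewrite distrC (le_trans (H _ _)) ?ler_norm.
  by rewrite (le_trans (H _ _)) ?ler_norm.
Qed.

(** * Asymptotic dimension functions of lattices and of their union *)

Section lattice_ad.
Context {R : realType}.

(** The [r]-neighbourhoods of boxes of one colour are disjoint when the boxes are
    [r + r] apart. *)
Lemma ad_lattice_le k n (r : R) : 0 < r ->
  (ad (lattice k n : set (dsumR R)) r <= n%:R%:E)%E.
Proof.
move=> r0; set X : metricType R := (lattice k n : set (dsumR R)).
have [|x y j _|x y B _ _ B0 xyB|D [c [q [cn qD qr]]]] :=
    @slab_coloring R X setT n (fun x j => (val x : dsumR R) j) 0 (r + r).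
- exact: addr_gt0.
- exact: le_dsumR_dist.
- rewrite addr0 subspace_distE; apply: dsumR_dist_le => // j.
  have [/xyB//|nj] := ltnP j n.
  have [_ ->//] := set_valP x; have [_ ->//] := set_valP y.
  by rewrite subrr normr0.
apply: (@ad_le _ X n r (r + D + r) c
  (fun x => [set y | exists z, [/\ c z = c x, q z = q x & mdist z y < r]])) => //.
- by move=> x y; rewrite ballEmdist /= => xy; exists x.
- move=> x y z [y' [cy qy yy]] [z' [cz qz zz]].
  apply: le_trans (metric_triangle _ z' _) _; apply: lerD; last exact: ltW.
  apply: le_trans (metric_triangle _ y' _) _; apply: lerD.
    by rewrite metric_sym ltW.
  by apply: qD => //; rewrite ?cy ?qy.
- move=> x y cxy [p [[x' [cx qx xp]] [y' [cy qy yp]]]].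
  suff qxy : q x = q y by rewrite cxy qxy.
  rewrite -qx -qy; apply: contrapT => /qr; rewrite cx cy => /(_ cxy).
  apply/negP; rewrite -ltNge; apply: le_lt_trans (metric_triangle _ p _) _.
  by rewrite ltrD// metric_sym.
Qed.

(** At scales up to the step of the lattice, the balls are singletons. *)
Lemma ad_lattice_le0 k n (r : R) : 0 < r -> r <= 2 ^+ k ->
  (ad (lattice k n : set (dsumR R)) r <= 0)%E.
Proof.
move=> r0 rk; set X : metricType R := (lattice k n : set (dsumR R)).
apply: (@ad_le _ X 0 r 0 (fun=> 0%N) (fun x => [set x])) => //.
- move=> x y; rewrite ballEmdist /= => xy; apply: contrapT => /nesym/lattice_dist_ge.
  by apply/negP; rewrite -ltNge (lt_le_trans xy).
- by move=> x y z -> ->; rewrite mdistxx.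
- by move=> x y _ [z [/= -> ->]].
Qed.

Lemma ad_lattice_eq k n (r : R) : (0 < n)%N -> 0 < r ->
  ad (lattice k n : set (dsumR R)) r = n%:R%:E <-> 2 ^+ k < r.
Proof.
move=> n0 r0; split=> [adE|kr].
  rewrite ltNge; apply/negP => /(ad_lattice_le0 n r0); rewrite adE lee_fin.
  by rewrite lern0 => /eqP n_0; rewrite n_0 in n0.
apply/eqP; rewrite eq_le ad_lattice_le//=.
by apply: grid_le_ad kr (lattice_grid k n); rewrite exprn_gt0.
Qed.

Variable g : R -> nat.

(** When [gtilde] takes its default value [0], the step is [1]; otherwise its
    value is one of the exponents found in [ad_lattice_eq]. *)
Lemma gtilde_lt r : 1 < r -> (0 < g r)%N -> 2 ^+ gtilde g r < r.
Proof.
move=> r1 g0; rewrite /gtilde; case: xgetP => [k -> [[_ adk] _]|_].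
  by apply/(ad_lattice_eq _ g0); rewrite // (lt_trans _ r1).
by rewrite expr0.
Qed.

Lemma gtilde_ge r k : 0 < r -> (0 < g r)%N -> (0 < k)%N -> 2 ^+ k < r ->
  (k <= gtilde g r)%N.
Proof.
move=> r0 g0 k0 kr; have gk : gtilde_set g r k by split=> //; apply/ad_lattice_eq.
have exg : exists k, `[< gtilde_set g r k >] by exists k; apply/asboolP.
have ubg j : `[< gtilde_set g r j >] -> (j <= Num.truncn r)%N.
  move=> /asboolP[_ /(ad_lattice_eq _ g0 r0) jr].
  rewrite truncn_ge_nat ?ltW//; apply: le_lt_trans jr.
  by rewrite -natrX ler_nat ltnW// ltn_expl.
rewrite /gtilde; case: xgetP => [j _ [_ ->//]|].
case: (ex_maxnP exg ubg) => j /asboolP gj maxj /(_ j) []; split=> // i gi.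
by apply/maxj/asboolP.
Qed.

Hypothesis g_pos : forall r : R, 0 < r -> (0 < g r)%N.
Hypothesis g_incr : forall r s : R, 0 < r -> r <= s -> (g r <= g s)%N.

Lemma Xomega_grid i : exists e : seq nat -> Xomega g,
  grid_embedding (g i.+1%:R) (2 ^+ gtilde g i.+1%:R) e.
Proof. by eexists; apply: summand_grid; exact: lattice_grid. Qed.

(** The summand of index [i + 1], where i < r <= i + 1, has step less than
    [i + 1]; the step is an integer, so it is at most [i], which is less than
    [r]. *)
Lemma ad_Xomega_ge r : 1 < r -> ((g r)%:R%:E <= ad (Xomega g) r)%E.
Proof.
move=> r1; have r0 : 0 < r by rewrite (lt_trans _ r1).
have [i ri ir] : exists2 i, r <= i.+1%:R & i%:R < r.
  have /andP[] := truncn_itv (ltW r0); rewrite le_eqVlt => /predU1P[E _|lt gt].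
    case: (Num.truncn r) E => [E|i E]; first by rewrite -E ltxx in r0.
    by exists i; rewrite -E// ltr_nat.
  by exists (Num.truncn r) => //; exact: ltW.
have i0 : 1 < i.+1%:R :> R by exact: lt_le_trans ri.
have [e he] := Xomega_grid i.
apply: (@le_trans _ _ (g i.+1%:R)%:R%:E).
  by rewrite lee_fin ler_nat g_incr.
apply: grid_le_ad he; first by rewrite exprn_gt0.
apply: le_lt_trans ir; have := gtilde_lt i0 (g_pos (lt_trans ltr01 i0)).
by rewrite -natrX ltr_nat ler_nat ltnS.
Qed.

(** The tag of a point is the index of its summand minus one, so these are the
    summands of index up to [m]. *)
Definition near_part (m : nat) : set (Xomega g) := [set x | (tag x < m)%N].

(** Beyond index 2^a, the gaps between summands are larger than 2^a, and the steps
    inside the summands are at least 2^a since [a] is then admissible in the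
    definition of [gtilde]. *)
Lemma far_dist a (x y : Xomega g) : (0 < a)%N -> ~ near_part (2 ^ a) x ->
  ~ near_part (2 ^ a) y -> x <> y -> a.+1%:R <= mdist x y.
Proof.
move=> a0 /negP; rewrite -leqNgt => xa /negP; rewrite -leqNgt => ya xy.
have a2 : (a < 2 ^ a)%N by rewrite ltn_expl.
have [txy|txy] := pselect (tag x = tag y); last first.
  rewrite asunion_distE; apply: ler_wpDl; first exact: mdist_ge0.
  apply: le_trans (asgap_gt _); last by move=> -[].
  by rewrite ler_nat; lia.
case: x y txy xa ya xy => [i x] [j y] /= ij; case: _ / ij y => y ia _ xy.
rewrite (@summand_dist _ _ _ i x y).
apply: le_trans (lattice_dist_ge _); last by move=> E; apply: xy; rewrite E.
rewrite -natrX ler_nat; apply: leq_trans a2 _; rewrite leq_exp2l//.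
have i0 : 0 < i.+1%:R :> R by rewrite ltr0n.
by apply: gtilde_ge => //; rewrite ?g_pos// -natrX ltr_nat ltnS.
Qed.
End lattice_ad.

(** * Finite ordinals as bounds of Ord *)

Lemma ole_refl a : ole a a.
Proof. by elim: a => K f IH i; exists i; exact: IH. Qed.

Lemma ole_trans b a c : ole a b -> ole b c -> ole a c.
Proof.
elim: a b c => K f IH [L h] [M k] /= ab bc i.
by have [j fh] := ab i; have [l hk] := bc j; exists l; exact: IH hk.
Qed.

Lemma Ord_le_card (M : set {fset nat}) (n : nat) :
  M `<=` FinN -> (forall t, M t -> (#|` t| <= n)%N) -> Ord_le M (onat n).
Proof.
elim: n M => [|n IH] M MF Mn.
  apply: Ord_le_empty; rewrite -subset0 => t Mt.
  by have := Mn _ Mt; rewrite leqn0 cardfs_eq0 (negPf (MF _ Mt).1).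
apply: Ord_le_pos => [|a a0]; first by exists tt => -[].
exists (onat n); first by exists tt; exact: ole_refl.
apply: IH => [t []//|t [_ /Mn + ta]].
by rewrite -ltnS cardfsU ta cardfs0 subn0 cardfs1 addn1.
Qed.

Lemma card_Ord_le (M : set {fset nat}) b n t :
  Ord_le M b -> ole b (onat n) -> FinN t -> M t -> (#|` t| <= n)%N.
Proof.
elim: n M b t => [|n IH] M b t [M0|b0 Mb] bn Ft Mt.
- by rewrite M0 in Mt.
- by case: b b0 bn {Mb} => L h [j _] /(_ j)[].
- by rewrite M0 in Mt.
have [t0 nt0] := Ft; have [a at_] := fset0Pn _ t0.
have a0 : (0 < a)%N by rewrite lt0n; apply: contraNneq nt0 => <-.
have [c cb linkc] := Mb a a0.
have cn : ole c (onat n).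
  case: b bn cb {Mb b0} => L h /= bn [j cj].
  by have [_] := bn j; exact: ole_trans.
rewrite (cardfsD1 a) at_ add1n ltnS.
have [ta0|ta0] := eqVneq (t `\ a)%fset fset0; first by rewrite ta0 cardfs0.
have Fta : FinN (t `\ a)%fset.
  by split=> //; rewrite !inE negb_and nt0 orbT.
apply: (IH _ _ _ linkc cn Fta); split => //.
  by rewrite fsetUC fsetD1K.
by apply/fsetP => x; rewrite !inE; case: (x == a); rewrite ?andbF.
Qed.


(** * The transfinite asymptotic dimension *)

Section Xomega_trasdim.
Context {R : realType}.
Variable g : R -> nat.
Hypothesis g_pos : forall r : R, 0 < r -> (0 < g r)%N.
Hypothesis g_incr : forall r s : R, 0 < r -> r <= s -> (g r <= g s)%N.

(** Forgetting the summand maps the near part to R^m with [m] the largest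
    dimension of its summands, and changes distances by a bounded amount. *)
Lemma near_part_coloring m (r : R) : 0 < r ->
  exists D (c : Xomega g -> nat) (q : Xomega g -> seq int),
    [/\ forall x, (c x <= g m%:R)%N,
        forall x y, near_part m x -> near_part m y ->
          c x = c y -> q x = q y -> mdist x y <= D &
        forall x y, c x = c y -> q x <> q y -> r <= mdist x y].
Proof.
move=> r0; apply: (@slab_coloring R (Xomega g) (near_part m) (g m%:R)
  (fun x j => (aspoint x : dsumR R) j) (\sum_(0 <= j < m) j%:R)) => //.
- move=> x y j _; rewrite asunion_distE; apply: ler_wpDr; first exact: asgap_ge0.
  exact: le_dsumR_dist.
- move=> x y B xm ym B0 xyB; rewrite asunion_distE; apply: lerD; last exact: asgap_le.
  have vanish (z : Xomega g) j : near_part m z -> (g m%:R <= j)%N ->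
      (aspoint z : dsumR R) j = 0.
    move=> zm mj; have [_ ->//] := set_valP (tagged z).
    by apply: leq_trans mj; rewrite g_incr ?ltr0n// ler_nat.
  apply: dsumR_dist_le => // j; have [/xyB//|mj] := ltnP j (g m%:R).
  by rewrite !vanish// subrr normr0.
Qed.

(** If the number of elements of [t] exceeded the dimensions in the near part,
    every colour of its boxes would get an element of [t] as scale, while the far part
    is covered by singletons at scale [a]. *)
Lemma link_A_family_card a t : (0 < a)%N ->
  link (A_family (Xomega g)) [fset a]%fset t -> (#|` t| <= g (2 ^ a)%:R)%N.
Proof.
move=> a0 [[_ t0] [_ nF] ta]; rewrite leqNgt; apply/negP => tm; apply: nF.
set m := (2 ^ a)%N in tm *.
have at_ : a \notin t.
  by apply/negP => at_; have := in_fset0 a; rewrite -ta !inE at_ eqxx.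
have [r tr] : exists r : R, forall j, j \in t -> j%:R + 1 <= r.
  exists ((\max_(j <- t) j)%N%:R + 1) => j jt.
  by rewrite lerD2r ler_nat (@leq_bigmax_seq _ _ xpredT id).
have r0 : 0 < `|r| + 1 by rewrite ltr_wpDl.
have [D [c [q [cm qD qr]]]] := near_part_coloring m r0.
pose C x := nth 0%N t (c x).
have Ct x : C x \in t by rewrite mem_nth// (leq_ltn_trans (cm x)).
pose near_class x := [set y | [/\ near_part m y, c y = c x & q y = q x]].
exists (fun j => if j == a then [set [set x] | x in ~` near_part m]
  else [set near_class x | x in [set x | near_part m x /\ C x = j]]).
split=> [j|].
  rewrite !inE; have [-> _|ja] := eqVneq j a; last rewrite orbF => jt.
    split.
      apply/uniformly_boundedP; exists 0 => _ [z _ <-] x y -> ->.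
      by rewrite mdistxx.
    apply: (@r_disjoint_gap _ _ _ a.+1%:R); first by rewrite ltr_nat.
    move=> _ _ _ _ [x fx <-] [y fy <-] xy -> ->; apply: far_dist => // E.
    by apply: xy; rewrite E.
  split.
    apply/uniformly_boundedP; exists D => _ [z _ <-] x y [nx cx qx] [ny cy qy].
    by apply: qD; rewrite ?cx ?qx.
  apply: (@r_disjoint_gap _ _ _ (`|r| + 1)).
    have := tr j jt; have := ler_norm r; lra.
  move=> _ _ u v [x [nx Cx] <-] [y [ny Cy] <-] xy [nu cu qu] [nv cv qv].
  have cxy : c x = c y.
    apply/eqP; rewrite -(nth_uniq 0%N _ _ (fset_uniq t)) ?(leq_ltn_trans (cm _))//.
    by apply/eqP; rewrite -/(C x) -/(C y) Cx Cy.
  apply: qr; first by rewrite cu cv.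
  by rewrite qu qv => qxy; apply: xy; rewrite /near_class cxy qxy.
apply/seteqP; split=> // x _; have [nx|fx] := pselect (near_part m x).
  exists (near_class x); last by split.
  exists (C x); first by rewrite /= !inE Ct.
  by rewrite ifN; [exists x|apply: contraNneq at_ => <-].
exists [set x] => //; exists a; first by rewrite /= !inE eqxx orbT.
by rewrite eqxx; exists x.
Qed.

Hypothesis g_lim : g r @[r --> +oo] --> \oo.

Lemma exists_large_dimension n : exists i, (n <= g i.+1%:R)%N.
Proof.
have [M [_ MP]] := g_lim (nbhs_infty_ge n).
exists (Num.truncn M); apply: MP; exact: truncnS_gt.
Qed.

(** Consecutive integers, starting at the step of a lattice of dimension more than
    [n]. *)
Lemma A_family_Xomega_card n :
  exists t, [/\ FinN t, A_family (Xomega g) t & #|` t| = n.+1].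
Proof.
have [i ni] := exists_large_dimension n.+1; have [e he] := Xomega_grid g i.
set s := (2 ^ gtilde g i.+1%:R)%N.
have s0 : (0 < s)%N by rewrite expn_gt0.
exists (seq_fset tt (iota s n.+1)).
have st : #|` seq_fset tt (iota s n.+1)| = n.+1.
  by rewrite size_seq_fset undup_id ?iota_uniq// size_iota.
have sF : FinN (seq_fset tt (iota s n.+1)).
  split; first by rewrite -cardfs_gt0 st.
  by rewrite seq_fsetE mem_iota leqNgt s0.
split=> //; apply: grid_A_family he sF _ _; rewrite ?exprn_gt0 ?st// => j.
by rewrite seq_fsetE mem_iota -natrX ler_nat => /andP[].
Qed.

Lemma trasdim_Xomega : trasdim_eq (Xomega g) omega.
Proof.
split=> [|[b [n bn] Ab]].
  apply: Ord_le_pos => [|a a0]; first by exists 0%N => -[].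
  exists (onat (g (2 ^ a)%:R)); first by exists (g (2 ^ a)%:R); exact: ole_refl.
  by apply: Ord_le_card => [t []//|t]; exact: link_A_family_card.
have [t [Ft At tn]] := A_family_Xomega_card n.
by have := card_Ord_le Ab bn Ft At; rewrite tn ltnn.
Qed.
End Xomega_trasdim.

Unset Implicit Arguments.

Theorem proposition5p2 (R : realType) (g : R -> nat)
    (g_pos : forall r : R, 0 < r -> (0 < g r)%N)
    (g_incr : forall r s : R, 0 < r -> r <= s -> (g r <= g s)%N)
    (g_lim : g r @[r --> +oo] --> \oo) :
  trasdim_eq (Xomega g) omega /\
  (forall r : R, 1 < r -> ((g r)%:R%:E <= ad (Xomega g) r)%E).
Proof.
split; first exact: trasdim_Xomega.
by move=> r; exact: ad_Xomega_ge.
Qed.
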